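(* Let $\Omega$ be a finite space of elementary events with an algebra $\mathcal F$ and a filtration $\{\mathcal F_n\}_{n=0}^N$, and let $M$ be a complete convex set of equivalent measures on $(\Omega,\mathcal F)$, where the set $A_0$ contains an element $\xi_0\ne1$. Then every super-martingale $\{f_m,\mathcal F_m\}_{m=0}^N$ relative to $M$ is local regular.
   Context: $\Omega$ is finite, $\mathcal F$ is an algebra of subsets of $\Omega$, $\mathcal F_0\subset\mathcal F_1\subset\dots\subset\mathcal F_N=\mathcal F$ are algebras, $\mathcal F_0=\{\emptyset,\Omega\}$. $M$ is a convex set of pairwise equivalent probability measures on $\mathcal F$. Standing assumption: for all $P,Q\in M$ the density $\frac{dP}{dQ}$ is $\mathcal F_1$-measurable and $P_0\left(\frac{dP}{dQ}>0\right)=1$, where $P_0\in M$ is fixed. Super-martingale relative to $M$: an adapted process $\{f_m\}_{m=0}^N$ with $E^P|f_m|<\infty$ and $E^P\{f_m|\mathcal F_k\}\le f_k$ for all $0\le k\le m\le N$, $P\in M$. It is local regular if $\sup_{P\in M}E^P|f_m|<\infty$ for $1\le m\le N$ and there is an adapted nonnegative increasing (non-decreasing in $m$) process $\{g_m\}_{m=0}^N$, $g_0=0$, $\sup_{P\in M}E^P|g_m|<\infty$, such that $\{f_m+g_m,\mathcal F_m\}_{m=0}^N$ is a martingale relative to every measure from $M$. $A_0$ is the set of all nonnegative random variables $\xi$ with $E^P\xi=1$ for all $P\in M$. Fix $\xi_0\in A_0$, $\xi_0\neq1$, and let $m_n=E^P\{\xi_0|\mathcal F_n\}$ (which does not depend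 on $P\in M$). The algebra $\mathcal F_n$ is generated by a partition $A_1^n,\dots,A_{N_n}^n$ of $\Omega$. Write $d^n=m_n-m_{n-1}=\sum_{j=1}^{N_n}d_j^n\chi_{A_j^n}$, $I_n^-=\{j:d_j^n\le0\}$, $I_n^+=\{j:d_j^n>0\}$. $M_n$ is the set of restrictions of measures of $M$ to $\mathcal F_n$, with metric $$\rho_n(P_1,P_2)=\max_B\sum_{s=1}^k|P_1(B_s)-P_2(B_s)|,$$ the maximum being over all partitions $B=\{B_1,\dots,B_k\}$ of $\Omega$ into sets of $\mathcal F_n$. $M$ is called complete if for every $1\le n\le N$ the closure of $M_n$ in the metric $\rho_n$ contains, for every $i\in I_n^-$ and $j\in I_n^+$, the probability measure $P_{ij}^n$ on $\mathcal F_n$ with $$P_{ij}^n(A_i^n)=\frac{d_j^n}{-d_i^n+d_j^n},\quad P_{ij}^n(A_j^n)=\frac{-d_i^n}{-d_i^n+d_j^n},\quad P_{ij}^n(A_l^n)=0\ \ (l\ne i,j).$$ *)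

(* Defs.v *)
From HB Require Import structures.
From mathcomp Require Import all_boot all_order all_algebra.
From mathcomp Require Import all_classical all_reals all_analysis.
Set Implicit Arguments.
Unset Strict Implicit.
Unset Printing Implicit Defensive.
Import Order.TTheory GRing.Theory Num.Theory.
Import numFieldNormedType.Exports.
Local Open Scope classical_set_scope.
Local Open Scope ring_scope.

Definition set_algebra (T : Type) (G : set (set T)) : Prop :=
  setring G /\ G setT.

(* The ambient algebra on [Omega] is [measurable]; [Omega] will be finite, so
   that there is no difference between algebras and sigma-algebras, and
   [G.-sigma.-measurable] is [G] for every algebra [G]. *)
Definition filtration d (Omega : measurableType d) (N : nat)
    (F : nat -> set (set Omega)) : Prop :=
  [/\ F 0%N = [set set0; setT],
      (forall n, (n <= N)%N -> set_algebra (F n)),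
      (forall n, (n < N)%N -> F n `<=` F n.+1) &
      F N = measurable].

Definition generated_by (T : Type) (G : set (set T)) (k : nat)
    (A : 'I_k -> set T) : Prop :=
  partition setT A setT /\ G = smallest (@set_algebra T) (range A).

Definition measurable_wrt d (Omega : measurableType d) (R : realType)
    (G : set (set Omega)) (f : Omega -> R) : Prop :=
  measurable_fun [set: g_sigma_algebraType G]
    (f : g_sigma_algebraType G -> R).

Definition adapted d (Omega : measurableType d) (R : realType) (N : nat)
    (F : nat -> set (set Omega)) (f : nat -> Omega -> R) : Prop :=
  forall n, (n <= N)%N -> measurable_wrt (F n) (f n).

Section families_of_measures.
Context d (Omega : measurableType d) (R : realType).
Implicit Types (M : set (probability Omega R)) (P Q : probability Omega R).

(* Two elements of [probability Omega R] may differ outside [measurable], so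
   that the convex combination is only required up to agreement on
   [measurable]. *)
Definition convex_family M : Prop :=
  forall P Q (t : R), M P -> M Q -> 0 <= t <= 1 ->
    exists2 S : probability Omega R, M S &
      forall B, measurable B -> (S B = t%:E * P B + (1 - t)%:E * Q B)%E.

Definition pairwise_equivalent M : Prop :=
  forall P Q, M P -> M Q -> P `<< Q /\ Q `<< P.

(* [phi] is a version of the density dP/dQ. *)
Definition is_density P Q (phi : Omega -> R) : Prop :=
  [/\ measurable_fun setT phi, (forall w, 0 <= phi w) &
      forall B, measurable B -> P B = (\int[Q]_(w in B) (phi w)%:E)%E].

Definition densities_F1 (F1 : set (set Omega)) M P0 : Prop :=
  forall P Q, M P -> M Q ->
    exists phi : Omega -> R,
      [/\ is_density P Q phi, measurable_wrt F1 phi &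
          P0 [set w | 0 < phi w] = 1%E].

(* [h] is a version of the conditional expectation of [f] given [G]. *)
Definition is_cond_exp P (G : set (set Omega)) (f h : Omega -> R) : Prop :=
  [/\ measurable_wrt G h, P.-integrable setT (EFin \o h) &
      forall B, G B ->
        (\int[P]_(w in B) (h w)%:E = \int[P]_(w in B) (f w)%:E)%E].

Definition supermartingale M (N : nat) (F : nat -> set (set Omega))
    (f : nat -> Omega -> R) : Prop :=
  [/\ adapted N F f,
      (forall P n, M P -> (n <= N)%N -> ('E_P[fun w => `|f n w|%R] < +oo)%E) &
      forall P k n, M P -> (k <= n <= N)%N ->
        exists2 h, is_cond_exp P (F k) (f n) h &
          {ae P, forall w, h w <= f k w}].

Definition martingale M (N : nat) (F : nat -> set (set Omega))
    (f : nat -> Omega -> R) : Prop :=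
  [/\ adapted N F f,
      (forall P n, M P -> (n <= N)%N -> ('E_P[fun w => `|f n w|%R] < +oo)%E) &
      forall P k n, M P -> (k <= n <= N)%N ->
        is_cond_exp P (F k) (f n) (f k)].

Definition local_regular M (N : nat) (F : nat -> set (set Omega))
    (f : nat -> Omega -> R) : Prop :=
  (forall n, (1 <= n <= N)%N ->
     (ereal_sup [set 'E_P[fun w => `|f n w|%R] | P in M] < +oo)%E) /\
  exists g : nat -> Omega -> R,
    [/\ adapted N F g /\ g 0%N = cst 0,
        (forall n w, (n <= N)%N -> 0 <= g n w),
        (forall n w, (n < N)%N -> g n w <= g n.+1 w),
        (forall n, (n <= N)%N ->
           (ereal_sup [set 'E_P[fun w => `|g n w|%R] | P in M] < +oo)%E) &
        martingale M N F (fun n w => f n w + g n w)].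

Definition A0 M : set (Omega -> R) :=
  [set xi : Omega -> R | [/\ measurable_fun setT xi, (forall w, 0 <= xi w) &
                forall P, M P -> ('E_P[xi] = 1)%E]].

Definition restrictions M (G : set (set Omega)) :
    set (probability (g_sigma_algebraType G) R) :=
  [set mu | exists2 P, M P & forall B, G B -> mu B = P B].

Definition rho (G : set (set Omega))
    (mu nu : probability (g_sigma_algebraType G) R) : \bar R :=
  ereal_sup [set r | exists k (B : 'I_k -> set Omega),
    [/\ partition setT B setT, (forall s, G (B s)) &
        r = (\sum_(s < k) `|mu (B s) - nu (B s)|)%E]].

Definition rho_closure (G : set (set Omega))
    (S : set (probability (g_sigma_algebraType G) R)) :
    set (probability (g_sigma_algebraType G) R) :=
  [set mu | forall e : R, 0 < e ->
     exists2 nu, S nu & (rho mu nu < e%:E)%E].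

(* [A n] is the partition generating [F n], and [delta n j] is the value on
   [A n j] of the [n]-th martingale difference of the process
   E(xi0 | F n). *)
Definition complete_family M (N : nat) (F : nat -> set (set Omega))
    (K : nat -> nat) (A : forall n, 'I_(K n) -> set Omega)
    (delta : forall n, 'I_(K n) -> R) : Prop :=
  forall n, (1 <= n <= N)%N ->
  forall i j : 'I_(K n), delta n i <= 0 -> 0 < delta n j ->
    exists2 mu : probability (g_sigma_algebraType (F n)) R,
      rho_closure (@restrictions M (F n)) mu &
      [/\ mu (A n i) = (delta n j / (- delta n i + delta n j))%:E,
          mu (A n j) = (- delta n i / (- delta n i + delta n j))%:E &
          forall l : 'I_(K n), l != i -> l != j -> mu (A n l) = 0%E].

End families_of_measures.

(* Main.v *)
Require Import Defs.
From HB Require Import structures.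
From mathcomp Require Import all_boot all_order all_algebra.
From mathcomp Require Import all_classical all_reals all_analysis.
From mathcomp Require Import ring.
Import Order.TTheory GRing.Theory Num.Theory.
Import numFieldNormedType.Exports.
Local Open Scope classical_set_scope.
Local Open Scope ring_scope.

(** Write Delta_n = f_n - f_(n-1).  It suffices to find F_n-measurable
    gamma_n >= 0 with E^P(Delta_n + gamma_n | F_(n-1)) = 0 for every P in M,
    and then to take g_n = gamma_1 + ... + gamma_n.
    For n >= 2 the densities dP/dQ are F_(n-1)-measurable, so that
    E^P(f_n | F_(n-1)) does not depend on P and the Doob compensator
    f_(n-1) - E(f_n | F_(n-1)) works; completeness is not involved.
    For n = 1, choose some k with d^k > 0 on some atom, which exists since
    xi_0 is not 1.  Passing to the closure, E^mu Delta_1 <= 0 for the measures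
    mu = P_ij^k, that is, Delta_1(i) d_j^k <= Delta_1(j) d_i^k whenever
    d_i^k <= 0 < d_j^k.  Hence Delta_1 <= alpha d^k for a constant alpha, and
    conditioning on F_1 gives Delta_1 <= e = alpha E(d^k | F_1), where
    E^P e = 0 for every P, so that gamma_1 = e - Delta_1 works.
    All conditional expectations of d^k given F_1 are differences of values of
    the martingale m, with k replaced by min(k, 1) and k - 1 by min(k - 1, 1). *)

(** * Algebras generated by a finite partition *)

(** The sets that contain or miss each whole atom form a sigma-algebra to which the atoms belong; it
    therefore includes [G], and then [<<s G>>]. *)
Lemma generated_atom {T : Type} {G : set (set T)} {k : nat} {A : 'I_k -> set T}
    {B : set T} (j : 'I_k) :
  generated_by G A -> <<s G >> B -> A j `<=` B \/ A j `<=` ~` B.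
Proof.
move=> [[_ tA _] GE] GB.
pose C : set (set T) := [set B | forall l, A l `<=` B \/ A l `<=` ~` B].
suff /(_ B GB) /= /(_ j) : <<s G >> `<=` C by [].
have CC X : C X -> C (~` X).
  by move=> CX l; rewrite setCK; have [|] := CX l; [right|left].
have CI X Y : C X -> C Y -> C (X `&` Y).
  move=> CX CY l; have [AX|AX] := CX l; last by right => w /AX nX -[].
  have [AY|AY] := CY l; first by left => w Aw; split; [exact: AX|exact: AY].
  by right => w /AY nY -[].
apply: smallest_sub.
  split.
  - by move=> l; right => w _ [].
  - by move=> X CX; rewrite setTD; exact: CC.
  - move=> X CX l; have [[n An]|nA] := pselect (exists n, A l `<=` X n).
      by left => w /An; exists n.
    right => w Aw [n _ Xw]; have [An|An] := CX n l; last exact: An Aw Xw.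
    by apply: nA; exists n.
rewrite GE; apply: smallest_sub; last first.
  move=> _ [i _ <-] l; have [->|il] := eqVneq i l; first by left.
  right => w Aw Ai; move/eqP: il; apply; apply: (tA i l) => //.
  by exists w.
split; first split.
- by move=> l; right => w _ [].
- move=> X Y CX CY; rewrite -(setCK (X `|` Y)) setCU.
  exact: CC (CI _ _ (CC _ CX) (CC _ CY)).
- by move=> X Y CX CY; rewrite setDE; apply: CI => //; apply: CC.
- by move=> l; left => w _.
Qed.

Lemma generated_mem {T : Type} {G : set (set T)} {k : nat} {A : 'I_k -> set T}
    (j : 'I_k) :
  generated_by G A -> G (A j).
Proof.
by move=> [_ ->]; apply: (sub_smallest (@subset_refl _ (range A))); exact: imageT.
Qed.

(** The level set of [f] through [x] lies in [<<s G>>] and meets the atom [A j], hence contains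
    it. *)
Lemma measurable_wrt_atom (d : measure_display) (Omega : measurableType d)
    (R : realType) (G : set (set Omega)) (k : nat) (A : 'I_k -> set Omega)
    (f : Omega -> R) (j : 'I_k) (x y : Omega) :
  generated_by G A -> measurable_wrt G f -> A j x -> A j y -> f x = f y.
Proof.
move=> gA mf Ax Ay.
have : <<s G >> (f @^-1` [set f x]).
  by rewrite -[f @^-1` _]setTI; apply: mf => //; exact: measurable_set1.
move=> /(generated_atom j gA) [] sA; first exact/esym/(sA y).
by have := sA _ Ax; case.
Qed.

Lemma measurable_wrtW (d : measure_display) (Omega : measurableType d)
    (R : realType) (G H : set (set Omega)) (f : Omega -> R) :
  G `<=` H -> measurable_wrt G f -> measurable_wrt H f.
Proof.
move=> GH mf mT Y mY; have := mf (@measurableT _ _) Y mY.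
exact: sub_sigma_algebra2.
Qed.

Lemma measurable_wrt_measurable (d : measure_display) (Omega : measurableType d)
    (R : realType) (f : Omega -> R) :
  measurable_wrt measurable f <-> measurable_fun setT f.
Proof.
have E : <<s @measurable d Omega >> = measurable.
  exact/sigma_algebra_id/sigma_algebra_measurable.
split=> mf mT Y mY.
  by have := mf (@measurableT _ _) Y mY; rewrite /measurable /= E.
by have := mf (@measurableT _ _) Y mY; rewrite -[in X in X -> _]E.
Qed.

(** * Integrals as finite sums over atoms *)

Lemma atom_exists {T : Type} {k : nat} {A : 'I_k -> set T} (w : T) :
  partition setT A setT -> exists j, A j w.
Proof.
by move=> [cA _ _]; have : setT w by []; rewrite -cA => -[j _]; exists j.
Qed.

Lemma sum_indic_atom {T : Type} {R : realType} {k : nat} {A : 'I_k -> set T}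
    (F : 'I_k -> R) (j : 'I_k) (w : T) :
  trivIset setT A -> A j w -> \sum_(l < k) F l * \1_(A l) w = F j.
Proof.
move=> tA Aw; rewrite (bigD1 j)//= indicE mem_set// mulr1 big1 ?addr0// => l lj.
rewrite indicE memNset ?mulr0// => Al; move/eqP: lj; apply.
by apply: (tA l j) => //; exists w.
Qed.

(* With r choosing a point in each atom and p the masses of the atoms, this is
   the integral of f over B. *)
Definition atom_sum {T : Type} {R : realType} {k : nat} (r : 'I_k -> T)
    (p : 'I_k -> R) (B : set T) (f : T -> R) : R :=
  \sum_(j < k) f (r j) * \1_B (r j) * p j.

(** Being constant on atoms, [f] is a linear combination of their indicators, and each atom lies
    inside [B] or outside it. *)
Lemma integral_atoms (d : measure_display) (Omega : measurableType d)
    (R : realType) (G : set (set Omega)) (k : nat) (A : 'I_k -> set Omega)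
    (r : 'I_k -> Omega) (P : probability Omega R) (B : set Omega)
    (f : Omega -> R) :
  G `<=` measurable -> generated_by G A -> (forall j, A j (r j)) ->
  G B -> measurable_wrt G f ->
  (\int[P]_(w in B) (f w)%:E =
     (atom_sum r (fun j => fine (P (A j))) B f)%:E)%E.
Proof.
move=> GM gA rA GB mf; have mB := GM _ GB.
have mA j : measurable (A j) by apply: GM; exact: generated_mem j gA.
have iA j : P.-integrable B (fun w => (\1_(A j) w)%:E).
  by apply: integrableS (integrable_indic P (mA j)).
have fE w : (f w)%:E = (\sum_(j < k) (f (r j))%:E * (\1_(A j) w)%:E)%E.
  have [j Aj] := atom_exists w gA.1.
  under eq_bigr do rewrite -EFinM.
  rewrite sumEFin (sum_indic_atom _ j)//; last by case: gA => -[].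
  by congr EFin; apply: measurable_wrt_atom gA mf Aj (rA j).
under eq_integral do rewrite fE.
rewrite integral_sum//; last by move=> j; exact: integrableZl.
rewrite -sumEFin; apply: eq_bigr => j _.
rewrite integralZl// integral_indic// !EFinM -muleA; congr (_ * _)%E.
have [AB|AB] := generated_atom j gA (sub_sigma_algebra GB).
  rewrite (setIidl AB) indicE mem_set ?mul1e ?fineK ?fin_num_measure//.
  exact: AB.
rewrite indicE memNset ?mul0e; last exact: AB.
by rewrite (_ : _ `&` _ = set0) ?measure0//; apply/disjoints_subset.
Qed.

(** Change of measure: the density [phi] takes one value on each atom of [G] and factors out of the
    sum over that atom. A conditional expectation given [G] that is zero under [q] thus stays zero
    under [p]. *)
Lemma atom_sum_change (T : Type) (R : realType) (G : set (set T))
    (k l : nat) (A : 'I_l -> set T) (r : 'I_k -> T) (p q phi : 'I_k -> R)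
    (B : set T) (u : T -> R) :
  generated_by G A -> G B ->
  (forall i, atom_sum r q (A i) u = 0) ->
  (forall j, p j = phi j * q j) ->
  (forall i j j', A i (r j) -> A i (r j') -> phi j = phi j') ->
  atom_sum r p B u = 0.
Proof.
move=> gA GB uA pE phiA.
(* The factor 1 is expanded as the sum of the indicators of the atoms of [G]. *)
transitivity (\sum_(j < k) \sum_(i < l)
   (u (r j) * \1_B (r j) * p j) * \1_(A i) (r j)).
  apply: eq_bigr => j _; have [i Ai] := atom_exists (r j) gA.1.
  by rewrite (sum_indic_atom _ i)//; case: gA => -[].
rewrite exchange_big big1 // => i _.
have [AB|AB] := generated_atom i gA (sub_sigma_algebra GB); last first.
  apply: big1 => j _; have [/AB Br|nA] := pselect (A i (r j)).
    by rewrite [\1_B _]indicE memNset// mulr0 !mul0r.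
  by rewrite [X in _ * X]indicE memNset// mulr0.
have [[j0 Aj0]|nA] := pselect (exists j, A i (r j)); last first.
  apply: big1 => j _; rewrite [X in _ * X]indicE memNset ?mulr0// => Aj.
  by apply: nA; exists j.
transitivity (phi j0 * atom_sum r q (A i) u); last by rewrite uA mulr0.
rewrite /atom_sum mulr_sumr; apply: eq_bigr => j _.
have [Aj|nA] := pselect (A i (r j)); last first.
  by rewrite ![\1_(A i) _]indicE memNset// !(mulr0, mul0r).
rewrite ![\1_(A i) _]indicE mem_set// !mulr1 indicE mem_set ?mulr1; last exact: AB.
by rewrite pE (phiA i j j0)// mulrCA.
Qed.

(** * Passage to the closure and two-point measures *)

(** A linear functional of the atom masses is Lipschitz for [rho], since [A] is itself one of the
    partitions in the supremum. *)
Lemma rho_closure_le0 (d : measure_display) (Omega : measurableType d)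
    (R : realType) (M : set (probability Omega R)) (G : set (set Omega))
    (k : nat) (A : 'I_k -> set Omega) (D : 'I_k -> R)
    (mu : probability (g_sigma_algebraType G) R) :
  generated_by G A ->
  (forall P, M P -> \sum_(l < k) D l * fine (P (A l)) <= 0) ->
  rho_closure (@restrictions _ _ _ M G) mu ->
  \sum_(l < k) D l * fine (mu (A l)) <= 0.
Proof.
(* [C] bounds every [|D l|]; the summand 1 keeps it positive even if [D] vanishes. *)
move=> gA MD clmu; set C := 1 + \sum_(l < k) `|D l|.
have C0 : 0 < C by rewrite ltr_pwDl// sumr_ge0.
apply/ler_addgt0Pr => e e0; rewrite add0r.
have [nu [P MP nuP] rhoe] := clmu (e / C) (divr_gt0 e0 C0).
have GA l : G (A l) by exact: generated_mem l gA.
have fin (m : probability (g_sigma_algebraType G) R) l : m (A l) \is a fin_num.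
  by apply: fin_num_measure; apply: sub_sigma_algebra.
have close : \sum_(l < k) `|fine (mu (A l)) - fine (nu (A l))| <= e / C.
  rewrite -lee_fin -sumEFin; apply: le_trans (ltW rhoe).
  apply: ereal_sup_ubound; exists k, A; split => //; first exact: gA.1.
  apply: eq_bigr => l _.
  by rewrite -[in RHS](fineK (fin mu l)) -[in RHS](fineK (fin nu l)).
have -> : \sum_(l < k) D l * fine (mu (A l)) =
   \sum_(l < k) D l * fine (P (A l)) +
   \sum_(l < k) D l * (fine (mu (A l)) - fine (nu (A l))).
  rewrite -big_split; apply: eq_bigr => l _ /=.
  by rewrite nuP// -mulrDr addrC subrK.
rewrite -[e]add0r lerD ?MD//.
apply: (@le_trans _ _ (C * (e / C))); last by rewrite mulrCA divff ?mulr1 ?gt_eqF.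
apply: le_trans (ler_wpM2l (ltW C0) close).
rewrite mulr_sumr; apply: ler_sum => l _.
apply: le_trans (ler_norm _) _; rewrite normrM ler_wpM2r//.
by rewrite /C (bigD1 l)//= addrCA lerDl addr_ge0// sumr_ge0.
Qed.

(** [alpha] is the largest ratio [D j / delta j] over [delta j > 0]. For [delta l <= 0], the
    hypothesis for [l] and the maximiser is divided by the positive [delta j]. *)
Lemma two_point_bound (R : realType) (k : nat) (D delta : 'I_k -> R)
    (j0 : 'I_k) :
  0 < delta j0 ->
  (forall i j, delta i <= 0 -> 0 < delta j -> D i * delta j <= D j * delta i) ->
  exists alpha, forall l, D l <= alpha * delta l.
Proof.
move=> j0_gt0 D2.
pose q j := D j / delta j.
have [j jpos jmax] :=
  @Order.TotalTheory.arg_maxP _ _ _ j0 (fun j => 0 < delta j) q j0_gt0.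
exists (q j) => l; have [l0|l0] := leP (delta l) 0.
  by rewrite /q mulrAC ler_pdivlMr// D2.
by rewrite -ler_pdivrMr//; exact: jmax.
Qed.

(** * Calculus of atom sums and conditional inequalities *)

Lemma atom_sumZ {T : Type} {R : realType} {k : nat} (r : 'I_k -> T)
    (p : 'I_k -> R) (B : set T) (c : R) (f : T -> R) :
  atom_sum r p B (fun w => c * f w) = c * atom_sum r p B f.
Proof.
by rewrite /atom_sum mulr_sumr; apply: eq_bigr => j _; rewrite !mulrA.
Qed.

Lemma atom_sumB {T : Type} {R : realType} {k : nat} (r : 'I_k -> T)
    (p : 'I_k -> R) (B : set T) (f g : T -> R) :
  atom_sum r p B (fun w => f w - g w) = atom_sum r p B f - atom_sum r p B g.
Proof.
by rewrite /atom_sum -sumrB; apply: eq_bigr => j _; rewrite !mulrBl.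
Qed.

(** Atoms of mass zero do not count, so relations valid only almost everywhere can be used under the
    sum. *)
Lemma atom_sum_eq {T : Type} {R : realType} {k : nat} (r : 'I_k -> T)
    (p : 'I_k -> R) (B : set T) (f g : T -> R) :
  (forall j, p j != 0 -> f (r j) = g (r j)) ->
  atom_sum r p B f = atom_sum r p B g.
Proof.
move=> fg; apply: eq_bigr => j _.
by have [->|/fg ->//] := eqVneq (p j) 0; rewrite !mulr0.
Qed.

Lemma atom_sum_le {T : Type} {R : realType} {k : nat} (r : 'I_k -> T)
    (p : 'I_k -> R) (B : set T) (f g : T -> R) :
  (forall j, 0 <= p j) ->
  (forall j, p j != 0 -> f (r j) <= g (r j)) ->
  atom_sum r p B f <= atom_sum r p B g.
Proof.
move=> p0 fg; apply: ler_sum => j _.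
have [->|/fg fgj] := eqVneq (p j) 0; first by rewrite !mulr0.
by rewrite !ler_wpM2r// indicE.
Qed.

(** Each side is a constant value times the mass of [B], which is positive because [p j] is. *)
Lemma atom_sum_const_le (T : Type) (R : realType) (k : nat) (r : 'I_k -> T)
    (p : 'I_k -> R) (B : set T) (f g : T -> R) (j : 'I_k) :
  (forall i, 0 <= p i) ->
  (forall i, B (r i) -> f (r i) = f (r j)) ->
  (forall i, B (r i) -> g (r i) = g (r j)) ->
  B (r j) -> p j != 0 ->
  atom_sum r p B f <= atom_sum r p B g -> f (r j) <= g (r j).
Proof.
move=> p0 fB gB Bj pj.
have E (u : T -> R) : (forall i, B (r i) -> u (r i) = u (r j)) ->
    atom_sum r p B u = u (r j) * \sum_(i < k) \1_B (r i) * p i.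
  move=> uB; rewrite mulr_sumr; apply: eq_bigr => i _; rewrite -mulrA.
  have [/uB ->//|nB] := pselect (B (r i)).
  by rewrite indicE memNset// mul0r !mulr0.
rewrite (E f fB) (E g gB) ler_pM2r// (bigD1 j)//= indicE mem_set// mul1r.
rewrite ltr_pwDl ?lt_neqAle ?p0 1?eq_sym ?pj// sumr_ge0// => i _.
by rewrite mulr_ge0// indicE.
Qed.

(** The null set of exceptions contains or misses the atom, and it cannot contain one of positive
    mass. *)
Lemma ae_atom (d : measure_display) (Omega : measurableType d)
    (R : realType) (k : nat) (A : 'I_k -> set Omega) (P : probability Omega R)
    (Q : Omega -> Prop) (j : 'I_k) (w : Omega) :
  generated_by measurable A -> {ae P, forall w, Q w} -> A j w ->
  fine (P (A j)) != 0 -> Q w.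
Proof.
move=> gA [Z [mZ PZ QZ]] Aw PA; apply: contrapT => nQ.
have Zw : Z w by apply: QZ.
have [AZ|AZ] := generated_atom j gA (sub_sigma_algebra mZ); last first.
  exact: AZ _ Aw Zw.
move/eqP: PA; apply.
have : (P (A j) <= P Z)%E by rewrite le_measure ?inE//; exact: generated_mem j gA.
by rewrite PZ measure_le0 => /eqP ->.
Qed.

(** Here [g] stands for E(h | G). Averaging [f <= h] over an atom of [G], on which [f] and [g] are
    constant, compares their values there. *)
Lemma conditional_le (T : Type) (R : realType) (G : set (set T)) (k l : nat)
    (A : 'I_l -> set T) (r : 'I_k -> T) (p : 'I_k -> R) (f g h : T -> R) :
  generated_by G A -> (forall j, 0 <= p j) ->
  (forall i w w', A i w -> A i w' -> f w = f w') ->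
  (forall i w w', A i w -> A i w' -> g w = g w') ->
  (forall w, f w <= h w) ->
  (forall B, G B -> atom_sum r p B h = atom_sum r p B g) ->
  forall j, p j != 0 -> f (r j) <= g (r j).
Proof.
move=> gA p0 fA gAA fh hg j pj; have [i Ai] := atom_exists (r j) gA.1.
apply: (@atom_sum_const_le _ _ _ r p (A i)) => //.
- by move=> i' Ai'; apply: fA Ai' Ai.
- by move=> i' Ai'; apply: gAA Ai' Ai.
- rewrite -(hg _ (generated_mem i gA)); apply: atom_sum_le => // *; exact: fh.
Qed.

(** Doob compensator: with [h] = E(f' | G) under [q], the maximum equals [f - h] wherever [q] has
    mass, so the summand is [f' - h]. Its conditional expectation is zero under [q], hence under [p]
    by [atom_sum_change]. *)
Lemma compensator_step (T : Type) (R : realType) (G : set (set T)) (k l : nat)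
    (A : 'I_l -> set T) (r : 'I_k -> T) (p q phi : 'I_k -> R)
    (f f' h : T -> R) (B : set T) :
  generated_by G A -> G B ->
  (forall B, G B -> atom_sum r q B h = atom_sum r q B f') ->
  (forall j, q j != 0 -> h (r j) <= f (r j)) ->
  (forall j, p j = phi j * q j) ->
  (forall i j j', A i (r j) -> A i (r j') -> phi j = phi j') ->
  atom_sum r p B (fun w => Num.max (f w - h w) 0 + (f' w - f w)) = 0.
Proof.
move=> gA GB hf' hf pE phiA.
transitivity (atom_sum r p B (fun w => f' w - h w)).
  apply: atom_sum_eq => j pj.
  have qj : q j != 0 by apply: contraNneq pj => qj; rewrite pE qj mulr0.
  by rewrite max_l ?subr_ge0 ?hf// addrC addrA subrK.
apply: (atom_sum_change _ _ _ _ _ _ _ _ _ _ _ _ gA GB _ pE phiA) => i.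
by rewrite atom_sumB hf' ?subrr//; exact: generated_mem i gA.
Qed.

(** * From increments to local regularity *)

Lemma filtration_mono (d : measure_display) (Omega : measurableType d) (N : nat)
    (F : nat -> set (set Omega)) (k n : nat) :
  filtration N F -> (k <= n <= N)%N -> F k `<=` F n.
Proof.
move=> [_ _ Fmono _] /andP[kn]; elim: n kn => [|n IHn] kn nN.
  by move: kn; rewrite leqn0 => /eqP ->.
move: kn; rewrite leq_eqVlt => /orP[/eqP -> //|kn].
by apply: subset_trans (Fmono n nN); apply: IHn => //; exact: ltnW.
Qed.

Lemma filtration_measurable (d : measure_display) (Omega : measurableType d)
    (N : nat) (F : nat -> set (set Omega)) (n : nat) :
  filtration N F -> (n <= N)%N -> F n `<=` measurable.
Proof.
move=> FF nN; have [_ _ _ <-] := FF.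
by apply: filtration_mono FF _; rewrite nN leqnn.
Qed.

(** The process [g] is the sequence of partial sums of the [gamma]. All integrals are computed on
    the finest atoms [A], whose finiteness makes every supremum over [M] finite. *)
Lemma local_regular_of_increments (d : measure_display)
    (Omega : measurableType d) (R : realType) (N : nat)
    (F : nat -> set (set Omega)) (M : set (probability Omega R)) (k : nat)
    (A : 'I_k -> set Omega) (r : 'I_k -> Omega) (f : nat -> Omega -> R) :
  filtration N F -> generated_by measurable A -> (forall j, A j (r j)) ->
  adapted N F f ->
  (forall n, (n < N)%N -> exists gamma : Omega -> R,
     [/\ measurable_wrt (F n.+1) gamma, (forall w, 0 <= gamma w) &
         forall P B, M P -> F n B ->
           atom_sum r (fun j => fine (P (A j))) B
             (fun w => gamma w + (f n.+1 w - f n w)) = 0]) ->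
  local_regular M N F f.
Proof.
move=> FF gA rA adf inc.
have subM n : (n <= N)%N -> F n `<=` measurable by exact: filtration_measurable.
have intE (P : probability Omega R) B n u : (n <= N)%N -> measurable B ->
    measurable_wrt (F n) u -> (\int[P]_(w in B) (u w)%:E =
      (atom_sum r (fun j => fine (P (A j))) B u)%:E)%E.
  move=> nN mB /(measurable_wrtW _ _ _ _ _ _ (subM n nN)).
  exact: integral_atoms.
have mabs n (u : Omega -> R) : measurable_wrt (F n) u ->
    measurable_wrt (F n) (fun w => `|u w|).
  by move=> mu; apply: measurableT_comp.
(* Masses are at most 1, which gives a bound that does not depend on [P]. *)
have Efin (P : probability Omega R) n u : (n <= N)%N -> measurable_wrt (F n) u ->
    ('E_P[fun w => `|u w|%R] <= (\sum_(j < k) `|u (r j)|)%:E)%E.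
  move=> nN mu; rewrite unlock (intE _ _ n)//; last exact: mabs.
  rewrite lee_fin; apply: ler_sum => j _; rewrite indicT mulr1.
  rewrite ler_piMr// -lee_fin fineK ?fin_num_measure ?probability_le1//;
  exact: generated_mem j gA.
have supfin n (u : Omega -> R) : (n <= N)%N -> measurable_wrt (F n) u ->
    (ereal_sup [set 'E_P[fun w => `|u w|%R] | P in M] < +oo)%E.
  move=> nN mu; apply: (@le_lt_trans _ _ (\sum_(j < k) `|u (r j)|)%:E); last first.
    exact: ltry.
  by apply: ge_ereal_sup => _ [P _ <-]; exact: Efin mu.
split; first by move=> n /andP[_ nN]; apply: supfin (adf n nN).
(* Indices from [N] on receive the zero function, so that choice applies to every [n]. *)
have /choice[gam gamP] : forall n, exists gamma : Omega -> R, (n < N)%N ->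
    [/\ measurable_wrt (F n.+1) gamma, (forall w, 0 <= gamma w) &
        forall P B, M P -> F n B -> atom_sum r (fun j => fine (P (A j))) B
          (fun w => gamma w + (f n.+1 w - f n w)) = 0].
  move=> n; have [/inc [g gP]|_] := ltnP n N; first by exists g.
  by exists (cst 0).
pose g n w := \sum_(i < n) gam i w.
have mg n : (n <= N)%N -> measurable_wrt (F n) (g n).
  move=> nN; apply: measurable_sum => i.
  have iN : (i < N)%N := leq_trans (ltn_ord i) nN.
  have [mi _ _] := gamP i iN.
  by apply: measurable_wrtW mi; apply: filtration_mono FF _; rewrite ltn_ord.
have mfg n : (n <= N)%N -> measurable_wrt (F n) (fun w => f n w + g n w).
  by move=> nN; apply: measurable_realfun.measurable_funD; [exact: adf|exact: mg].
exists g; split.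
- by split=> //; apply/funext => w; rewrite /g big_ord0.
- move=> n w nN; apply: sumr_ge0 => i _.
  by have [_ + _] := gamP i (leq_trans (ltn_ord i) nN); apply.
- move=> n w nN; rewrite /g big_ord_recr/= lerDl.
  by have [_ + _] := gamP n nN; apply.
- by move=> n nN; apply: supfin (mg n nN).
split=> // [P n MP nN|P m n MP /andP[mn nN]].
  by apply: le_lt_trans (Efin _ _ _ nN (mfg n nN)) _; rewrite ltry.
have mN := leq_trans mn nN.
split; first exact: mfg.
  apply/integrableP; split.
    apply/measurable_realfun.measurable_EFinP; apply/measurable_wrt_measurable.
    exact: measurable_wrtW (subM m mN) (mfg m mN).
  have := Efin P m _ mN (mfg m mN); rewrite unlock => /le_lt_trans; apply.
  exact: ltry.
move=> B FB; have mB := subM m mN _ FB.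
rewrite (intE _ _ m)//; last exact: mfg.
rewrite (intE _ _ n)//; last exact: mfg.
(* Telescoping from [m] up to [n]: each increment of [f + g] sums to zero over [B], since [F m] is
   included in the later algebras. *)
congr EFin; elim: n mn nN => [|n IHn] mn nN.
  by move: mn; rewrite leqn0 => /eqP ->.
move: mn; rewrite leq_eqVlt => /orP[/eqP -> //|mn].
rewrite (IHn mn (ltnW nN)); apply/esym/eqP; rewrite -subr_eq0 -atom_sumB.
have [_ _ gam0] := gamP n nN.
rewrite -[X in _ == X](gam0 P B MP); last first.
  by apply: (filtration_mono _ _ _ _ m n FF) FB; rewrite -ltnS mn ltnW.
apply/eqP; apply: atom_sum_eq => j _.
by rewrite /g big_ord_recr/=; ring.
Qed.

Lemma atom_sum_atom {T : Type} {R : realType} {k : nat} {A : 'I_k -> set T}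
    (r : 'I_k -> T) (p : 'I_k -> R) (j : 'I_k) (f : T -> R) :
  trivIset setT A -> (forall i, A i (r i)) ->
  atom_sum r p (A j) f = f (r j) * p j.
Proof.
move=> tA rA; rewrite /atom_sum (bigD1 j)//= indicE mem_set// mulr1.
rewrite big1 ?addr0// => i ij; rewrite indicE memNset ?mulr0 ?mul0r// => Aj.
by move/eqP: ij; apply; apply: tA => //; exists (r i).
Qed.

Lemma atom_sum0 {T : Type} {R : realType} {k : nat} (r : 'I_k -> T)
    (p : 'I_k -> R) (f : T -> R) : atom_sum r p set0 f = 0.
Proof. by apply: big1 => j _; rewrite indic0 mulr0 mul0r. Qed.

(** * Construction of the increments for a complete family *)

Theorem theorem9 (d : measure_display) (Omega : measurableType d)
    (R : realType) (N : nat) (F : nat -> set (set Omega))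
    (M : set (probability Omega R)) (P0 : probability Omega R)
    (xi0 : Omega -> R) (m : nat -> Omega -> R)
    (K : nat -> nat) (A : forall n : nat, 'I_(K n) -> set Omega)
    (delta : forall n : nat, 'I_(K n) -> R)
    (Omega_finite : finite_set [set: Omega])
    (F_filtration : filtration N F)
    (M_convex : convex_family M)
    (M_equivalent : pairwise_equivalent M)
    (M_P0 : M P0)
    (M_densities : densities_F1 (F 1%N) M P0)
    (A0_xi0 : A0 M xi0)
    (xi0_neq1 : ~ {ae P0, forall w, xi0 w = 1})
    (m_cond_exp : forall (P : probability Omega R) (n : nat),
       M P -> (n <= N)%N -> is_cond_exp P (F n) xi0 (m n))
    (A_generates : forall n : nat, (n <= N)%N -> generated_by (F n) (A n))
    (delta_values : forall n : nat, (1 <= n <= N)%N -> forall w : Omega,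
       m n w - m n.-1 w = \sum_(j < K n) delta n j * \1_(A n j) w)
    (M_complete : complete_family M N F A delta) :
  forall f : nat -> Omega -> R,
    supermartingale M N F f -> local_regular M N F f.
Proof.
have [F0E _ _ FNE] := F_filtration.
have FM n : (n <= N)%N -> F n `<=` measurable by exact: filtration_measurable.
have FF k n : (k <= n <= N)%N -> F k `<=` F n by exact: filtration_mono.
have gA : generated_by measurable (A N) by rewrite -FNE; exact: A_generates.
have reps n : (n <= N)%N -> exists r : 'I_(K n) -> Omega, forall j, A n j (r j).
  move=> nN; have [[_ _ ne] _] := A_generates n nN.
  have /choice[r rA] : forall j, exists w, A n j w by move=> j; exact: ne.
  by exists r.
have tA n : (n <= N)%N -> trivIset setT (A n).
  by move=> nN; have [[]] := A_generates n nN.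
have [r rA] := reps N (leqnn N).
pose p (P : probability Omega R) j := fine (P (A N j)).
have p_ge0 P j : 0 <= p P j by exact: fine_ge0.
have measI n u : (n <= N)%N -> measurable_wrt (F n) u ->
    @measurable_wrt d Omega R measurable u.
  by move=> nN; apply: measurable_wrtW; exact: FM.
have intE (P : probability Omega R) B u : measurable B ->
    measurable_wrt measurable u ->
    (\int[P]_(w in B) (u w)%:E = (atom_sum r (p P) B u)%:E)%E.
  by move=> mB mu; apply: (integral_atoms _ _ _ _ _ _ _ _ _ _ _ gA rA).
have cstE (P : probability Omega R) B (c : R) : measurable B ->
    (\int[P]_(w in B) c%:E = c%:E * P B)%E.
  by move=> mB; exact: integral_cst.
have [mxi _ xiE] := A0_xi0.
have mxi' : measurable_wrt measurable xi0 by apply/measurable_wrt_measurable.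
have mm P n : M P -> (n <= N)%N -> measurable_wrt (F n) (m n).
  by move=> MP nN; have [] := m_cond_exp P n MP nN.
have cexpS (P : probability Omega R) G u v : G `<=` measurable ->
    measurable_wrt measurable u -> measurable_wrt measurable v -> is_cond_exp P G u v ->
    forall B, G B -> atom_sum r (p P) B v = atom_sum r (p P) B u.
  move=> GM mu mv [_ _ uv] B GB; have := uv B GB.
  by rewrite !intE//; [case|exact: GM|exact: GM].
have mS P n B : M P -> (n <= N)%N -> F n B ->
    atom_sum r (p P) B (m n) = atom_sum r (p P) B xi0.
  move=> MP nN; apply: cexpS => //; first exact: FM.
    exact: measI (mm _ _ MP nN).
  exact: m_cond_exp.
have xiS P : M P -> atom_sum r (p P) setT xi0 = 1.
  by move=> MP; have := xiE P MP; rewrite unlock intE// => -[].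
move=> f [adf _ fcond].
apply: (local_regular_of_increments _ _ _ _ _ _ _ (A N) r) => // -[|n] nN.
  (* First increment. If no [delta n j] were positive, [m] would decrease from [m 0 = 1], so that
     [xi0 <= 1] almost surely; having mean 1, [xi0] would then be 1 almost surely. *)
  have [n /andP[n1 nN'] [j0 j0_gt0]] :
      exists2 n, (1 <= n <= N)%N & exists j, 0 < delta n j.
    apply: contrapT => nex; apply: xi0_neq1.
    have mle n w : (n <= N)%N -> m n w <= m 0%N w.
      elim: n => // n IHn nN'; apply: le_trans (IHn (ltnW nN')).
      rewrite -subr_le0 (delta_values n.+1)//; apply: sumr_le0 => j _.
      rewrite mulr_le0_ge0// ?indicE//; rewrite leNgt; apply/negP => dj.
      by apply: nex; exists n.+1 => //; exists j.
    have m0E w : m 0%N w = 1.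
      have [j Aj] := atom_exists w (A_generates 0%N isT).1.
      have A0T : A 0%N j = setT.
        have := generated_mem j (A_generates 0%N isT); rewrite F0E => -[] // A00.
        by move: Aj; rewrite A00.
      have m0c w' : m 0%N w' = m 0%N w.
        have Aj' : A 0%N j w' by rewrite A0T.
        exact: measurable_wrt_atom (A_generates 0%N isT) (mm _ 0%N M_P0 isT)
          Aj' Aj.
      have [_ _ m0xi] := m_cond_exp _ 0%N M_P0 isT.
      have : (\int[P0]_w (m 0%N w)%:E = 1)%E.
        rewrite m0xi; last by rewrite F0E; right.
        by have := xiE _ M_P0; rewrite unlock.
      under eq_integral do rewrite m0c.
      by rewrite cstE// probability_setT mule1 => -[].
    (* As [F N] is the whole algebra, [m N] and [xi0] agree on atoms of positive mass. *)
    have xi_le1 j : p P0 j != 0 -> xi0 (r j) <= 1.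
      move=> pj; have := mS P0 N (A N j) M_P0 (leqnn N).
      rewrite FNE => /(_ (generated_mem j gA)).
      rewrite !atom_sum_atom//; try exact: tA.
      by move=> /(mulIf pj) <-; rewrite -(m0E (r j)) mle.
    have p1 : \sum_(j < K N) p P0 j = 1.
      have := intE P0 setT (cst 1) measurableT (measurable_cst _).
      rewrite cstE// probability_setT mule1 => -[->].
      by apply: eq_bigr => j _; rewrite indicT mulr1 mul1r.
    have xi1 j : p P0 j != 0 -> xi0 (r j) = 1.
      move=> pj; apply/eqP; rewrite eq_sym -subr_eq0.
      (* Nonnegative terms with sum zero all vanish. *)
      have gap_ge0 i : true -> 0 <= (1 - xi0 (r i)) * p P0 i.
        move=> _; have [->|pi] := eqVneq (p P0 i) 0; first by rewrite mulr0.
        by rewrite mulr_ge0// subr_ge0 xi_le1.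
      have gap0 : \sum_(i < K N) (1 - xi0 (r i)) * p P0 i = 0.
        under eq_bigr do rewrite mulrBl mul1r.
        apply/eqP; rewrite sumrB p1 -(xiS _ M_P0) subr_eq0.
        by apply/eqP/eq_bigr => i _; rewrite indicT mulr1.
      have /eqP := psumr_eq0P gap_ge0 gap0 (erefl : xpredT j).
      by rewrite mulf_eq0 (negbTE pj) orbF.
    have mZ : measurable (~` (xi0 @^-1` [set 1])).
      by apply: measurableC; rewrite -[_ @^-1` _]setTI; exact: mxi.
    exists (~` (xi0 @^-1` [set 1])); split => //.
    have := intE P0 _ (cst 1) mZ (measurable_cst _).
    rewrite cstE// mul1e => ->; congr EFin; apply: big1 => j _.
    have [->|pj] := eqVneq (p P0 j) 0; first by rewrite mulr0.
    rewrite indicE memNset ?mulr0 ?mul0r//; apply; exact: xi1.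
  have [r' r'A] := reps n nN'.
  pose D w := f 1%N w - f 0%N w.
  have mD : measurable_wrt (F 1%N) D.
    apply: measurable_realfun.measurable_funB; first exact: adf.
    by apply: measurable_wrtW (adf 0%N isT); exact: FF.
  have mDn : measurable_wrt (F n) D.
    by apply: measurable_wrtW mD; apply: FF; rewrite n1.
  have DS P : M P -> atom_sum r (p P) setT D <= 0.
    move=> MP; have [h hf hle] := fcond P 0%N 1%N MP nN.
    rewrite /D atom_sumB subr_le0.
    rewrite -(cexpS P _ _ _ (FM 0%N isT) (measI _ _ nN (adf _ nN)) _ hf).
    - by apply: atom_sum_le => // j pj; apply: ae_atom gA hle (rA j) pj.
    - by apply: measI (isT : (0 <= N)%N) _; case: hf.
    - by rewrite F0E; right.
  (* The inequality E D <= 0 is rewritten over the atoms of [F n], the algebra on which the limit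
     measures live. *)
  have Dn P : M P -> \sum_(l < K n) D (r' l) * fine (P (A n l)) <= 0.
    move=> MP; have := DS P MP; rewrite -lee_fin -intE//; last exact: measI mD.
    have gAn := A_generates n nN'.
    rewrite (integral_atoms _ _ _ _ _ _ _ P setT D
      (FM n nN') gAn r'A _ mDn); last first.
      by apply: (FF 0%N n) => //; rewrite F0E; right.
    rewrite lee_fin; congr (_ <= _); apply: eq_bigr => l _.
    by rewrite indicT mulr1.
  have [alpha alphaP] : exists alpha, forall l, D (r' l) <= alpha * delta n l.
    (* The inequality [Dn] passes to the two-point measure [mu]; clearing its positive denominator
       [- delta n i + delta n j] yields the hypothesis. *)
    apply: (two_point_bound _ _ _ _ j0) => // i j i_le0 j_gt0.
    have n1N : (1 <= n <= N)%N by rewrite n1.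
    have [mu clmu [mui muj mul]] := M_complete n n1N i j i_le0 j_gt0.
    have := rho_closure_le0 _ _ _ _ _ _ _ _ _ (A_generates n nN') Dn clmu.
    have ij : j != i by apply: contraTneq j_gt0 => ->; rewrite -leNgt.
    rewrite (bigD1 i)//= (bigD1 j)//= big1 => [|l /andP[li lj]]; last first.
      by rewrite mul// mulr0.
    rewrite mui muj addr0 /= !mulrA -mulrDl.
    rewrite pmulr_lle0 ?invr_gt0 ?ltr_wpDl ?oppr_ge0//.
    by rewrite mulrN subr_le0.
  (* e is a version of E(alpha d^n | F_1), also when n = 1 *)
  pose n0 := minn n.-1 1.
  have n0N : (n0 <= N)%N by rewrite (leq_trans (geq_minr _ _)).
  pose e w := alpha * (m 1%N w - m n0 w).
  have me : measurable_wrt (F 1%N) e.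
    apply: measurable_realfun.measurable_funM => //.
    apply: measurable_realfun.measurable_funB; first exact: mm M_P0 nN.
    apply: measurable_wrtW (mm _ _ M_P0 n0N); apply: FF.
    by rewrite geq_minr.
  have De P j : M P -> p P j != 0 -> D (r j) <= e (r j).
    move=> MP; move: j.
    have gA1 := A_generates 1%N nN.
    apply: (conditional_le _ _ _ _ _ _ _ _ _ _
      (fun w => alpha * (m n w - m n.-1 w)) gA1) => //.
    - by move=> i w w' Aw Aw'; exact: measurable_wrt_atom gA1 mD Aw Aw'.
    - by move=> i w w' Aw Aw'; exact: measurable_wrt_atom gA1 me Aw Aw'.
    - move=> w; have [l Al] := atom_exists w (A_generates n nN').1.
      rewrite delta_values ?n1// (sum_indic_atom _ l)//; last exact: tA.
      by rewrite (measurable_wrt_atom _ _ _ _ _ _ D l w (r' l) (A_generates n nN')).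
    - move=> B FB; rewrite /e !atom_sumZ !atom_sumB; congr (_ * (_ - _)).
        rewrite !mS//; apply: (FF 1%N n) FB; rewrite n1//.
      (* For [n = 1] both terms are [m 0]. For [n >= 2] they are [m n.-1] and [m 1], which have the
         same sums over sets of [F 1]. *)
      rewrite /n0; have [->|n2] := posnP n.-1; first by rewrite min0n.
      rewrite (minn_idPr n2) !mS//; first exact: leq_trans (leq_pred n) nN'.
      by apply: (FF 1%N) FB; rewrite n2 (leq_trans (leq_pred n)).
  (* [D <= e] is known only on atoms of positive mass; the maximum gives nonnegativity
     everywhere. *)
  exists (fun w => Num.max (e w - D w) 0); split.
  - apply: measurable_realfun.measurable_maxr => //.
    exact: measurable_realfun.measurable_funB.
  - by move=> w; rewrite le_max lexx orbT.
  - move=> P B MP; rewrite F0E => -[] ->; first exact: atom_sum0.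
    rewrite (atom_sum_eq _ _ _ _ e); last first.
      by move=> j pj; rewrite max_l ?subr_ge0 ?(De _ _ MP)// /D subrK.
    rewrite /e atom_sumZ atom_sumB !mS// ?subrr ?mulr0//.
      by apply: (FF 0%N) => //; rewrite F0E; right.
    by apply: (FF 0%N) => //; rewrite F0E; right.

(* Later increments: the compensator computed under [P0] *)
have nN' := ltnW nN.
have [h hf hle] := fcond P0 n.+1 n.+2 M_P0 (introT andP (conj (leqnSn _) nN)).
have mh : measurable_wrt (F n.+1) h by case: hf.
have gAn := A_generates n.+1 nN'.
(* f_(n+1) >= h holds only almost everywhere, hence the maximum with 0 *)
exists (fun w => Num.max (f n.+1 w - h w) 0); split.
- apply: (measurable_wrtW _ _ _ (F n.+1)); first by apply: FF; rewrite leqnSn.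
  apply: measurable_realfun.measurable_maxr => //.
  by apply: measurable_realfun.measurable_funB => //; exact: adf.
- by move=> w; rewrite le_max lexx orbT.
move=> P B MP FB.
(* The density of [P] with respect to [P0] is [F 1]-measurable, hence constant on the atoms of
   [F n.+1]; this carries the compensator from [P0] to [P]. *)
have [phi [[mphi _ phiE] mphi1 _]] := M_densities P P0 MP M_P0.
apply: (compensator_step _ _ _ _ _ _ _ _ (p P0) (phi \o r) _ _ _ _ gAn FB).
- apply: cexpS hf; first exact: FM.
    exact: measI (adf _ nN).
  exact: measI mh.
- by move=> j pj; apply: ae_atom gA hle (rA j) pj.
- move=> j; have mA := generated_mem j gA.
  rewrite {1}/p phiE// intE//; last by apply/measurable_wrt_measurable.
  by rewrite /= atom_sum_atom//; exact: tA.
- move=> i j j' Aj Aj'; apply: measurable_wrt_atom gAn _ Aj Aj'.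
  by apply: measurable_wrtW mphi1; exact: FF.
Qed.
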